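(* Let $\gamma\in\mathbb N$, $\gamma\ge1$, let $\alpha\in\mathbb D$, and let $\varphi_\alpha(z)=\dfrac{z-\alpha}{1-\overline\alpha z}$ for $z\in\mathbb D$. The Berezin range of the composition operator $C_{\varphi_\alpha}$ acting on $\mathcal H_\gamma(\mathbb D)$ is convex if and only if $\alpha=0$.
   Context: $\mathbb D$ is the open unit disk in $\mathbb C$. For a positive integer $\gamma$, $\mathcal H_\gamma(\mathbb D)$ is the reproducing kernel Hilbert space of holomorphic functions on $\mathbb D$ with kernel $K_w(z)=(1-\overline wz)^{-\gamma}$, and $\widehat k_w=K_w/\|K_w\|$. $C_\varphi f=f\circ\varphi$. For a bounded operator $A$ on $\mathcal H_\gamma(\mathbb D)$, the Berezin symbol is $\widetilde A(w)=\langle A\widehat k_w,\widehat k_w\rangle$, $w\in\mathbb D$, and the Berezin range is $\mathrm{Ber}(A)=\{\widetilde A(w): w\in\mathbb D\}$. *)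

(* Defs.v *)
From mathcomp Require Import all_boot all_order all_algebra.
From mathcomp Require Import sesquilinear complex.
From mathcomp Require Import boolp classical_sets reals topology normedtype.
From mathcomp Require Import derive convex.

Set Implicit Arguments.
Unset Strict Implicit.
Unset Printing Implicit Defensive.

Import Order.TTheory GRing.Theory Num.Theory.
Import numFieldNormedType.Exports.

Local Open Scope classical_set_scope.
Local Open Scope complex_scope.
Local Open Scope ring_scope.

Definition disk (R : realType) : set R[i] := [set z | `|z| < 1].

(* On a function [F : C -> C], derivability in the direction 1 over the scalar
   field C is complex differentiability. *)
Definition holomorphic_on_disk (R : realType) (F : R[i] -> R[i]) : Prop :=
  forall z, disk z -> derivable (F : R[i]^o -> R[i]^o) z 1.

(* A reproducing kernel Hilbert space of holomorphic functions on the disk,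
   whose kernel function at [w] is [z |-> K w z].  An element [f] of the Hilbert
   space is the function [ev f] restricted to the disk: values of [ev f] outside
   the disk carry no information, and [ev_inj] makes the elements of the space
   the same thing as functions on the disk.  Forms of type
   [{dot _ for Num.conj}] are linear in their first argument. *)
Record rkhs (R : realType) (K : R[i] -> R[i] -> R[i]) := RKHS {
  space :> completeNormedModType R[i];
  inner : {dot space for Num.conj};
  norm_inner : forall f : space, `|f| ^+ 2 = inner f f;
  ev : space -> R[i] -> R[i];
  ev_linear : forall (a : R[i]) (f g : space) z, disk z ->
    ev (a *: f + g) z = a * ev f z + ev g z;
  ev_inj : forall f g : space,
    (forall z, disk z -> ev f z = ev g z) -> f = g;
  ev_holomorphic : forall f : space, holomorphic_on_disk (ev f);
  kernel : R[i] -> space;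
  ev_kernel : forall w z, disk w -> disk z -> ev (kernel w) z = K w z;
  reproducing : forall (f : space) w, disk w -> inner f (kernel w) = ev f w
}.

Definition kernel_gamma (R : realType) (gamma : nat) (w z : R[i]) : R[i] :=
  (1 - w^* * z) ^- gamma.

Section Operators.
Context (R : realType) (K : R[i] -> R[i] -> R[i]) (H : rkhs K).

(* [get] picks the element of [H] whose function is [f \o phi]; by [ev_inj] it
   is unique when it exists, which is the case for every [f] when [phi] is an
   automorphism of the disk and [K] is one of the kernels [kernel_gamma]. *)
Definition comp_op (phi : R[i] -> R[i]) (f : H) : H :=
  get [set g : H | forall z, disk z -> ev g z = ev f (phi z)].

Definition normalized_kernel (w : R[i]) : H := `|kernel H w|^-1 *: kernel H w.

Definition berezin_symbol (A : H -> H) (w : R[i]) : R[i] :=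
  inner H (A (normalized_kernel w)) (normalized_kernel w).

Definition berezin_range (A : H -> H) : set R[i] := berezin_symbol A @` @disk R.

End Operators.

Definition moebius (R : realType) (alpha z : R[i]) : R[i] :=
  (z - alpha) / (1 - alpha^* * z).

(* Main.v *)
(* The Berezin symbol of C_phi at w is B(w)^gamma, where
   B(w) = (1 - |w|^2) / (1 - conj(w) phi(w)), provided that K_w o phi belongs to
   the space. The latter is seen by hand: the monomials are norm limits of
   combinations of kernels, they have norm at most 1, and so the space contains
   the convergent expansion of K_w o phi, which is a constant multiple of
   ((1 - conj(alpha) z) / (1 - b z))^gamma with |b| < 1.

   For alpha <> 0 the range contains 1, omits 0, has 0 as a limit point, and is
   symmetric about the real axis. If it were convex, it would contain the real
   part of each of its elements, hence no element with nonpositive real part,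
   and arbitrarily small positive numbers c = B(w)^gamma. As B > 1 - |alpha| at
   the points w where B is real, such a B(w) is not real; as Re B > 0, its
   argument is (up to conjugation) at least 2 pi / gamma. On the segment from 0
   to w the argument of B starts at 0, so it takes the value pi / gamma, where
   B^gamma is negative: a contradiction. *)

Require Import Defs.
From mathcomp Require Import all_boot all_order all_algebra.
From mathcomp Require Import sesquilinear complex ring lra.
From mathcomp Require Import boolp classical_sets reals topology normedtype sequences.
From mathcomp Require Import interval_inference convex trigo.

Set Implicit Arguments.
Unset Strict Implicit.
Unset Printing Implicit Defensive.

Import Order.TTheory GRing.Theory Num.Theory.
Import numFieldNormedType.Exports.
Local Open Scope classical_set_scope.
Local Open Scope complex_scope.
Local Open Scope ring_scope.

(** * Limits of geometrically Cauchy sequences and the binomial series *)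

Lemma ger0_conjc (R : realType) (x : R[i]) : 0 <= x -> x^* = x.
Proof. exact: geC0_conj. Qed.

(** Nonnegative elements of [R[i]] are real, so the claim descends to geometric sequences in [R]. *)
Lemma geometric_small (R : realType) (C q e : R[i]) :
  0 <= C -> 0 <= q -> q < 1 -> 0 < e ->
  exists N, forall n, (N <= n)%N -> C * q ^+ n < e.
Proof.
move=> C0 q0 q1 e0.
have real x : 0 <= x -> exists y : R, x = y%:C.
  by move=> x0; exists (complex.Re x); rewrite RRe_real // ger0_real.
have [c cE] := real _ C0; have [p pE] := real _ q0.
have [d dE] := real _ (ltW e0).
move: C0 q0 q1 e0; rewrite {}cE {}pE {}dE.
rewrite (_ : 0 = 0%:C) // (_ : 1 = 1%:C) // !lecR !ltcR => c0 p0 p1 d0.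
have : (fun n => c * p ^+ n) @ \oo --> (0 : R).
  by apply: cvg_geometric; rewrite ger0_norm.
move=> /cvgrPdist_lt /(_ _ d0) [N _ HN]; exists N => n /HN /=.
rewrite sub0r normrN ger0_norm ?mulr_ge0 ?exprn_ge0 // => h.
by rewrite -rmorphXn -rmorphM ltcR.
Qed.

(** Stands in for a passage to the limit: two values are identified by comparing both with the n-th
    approximant. *)
Lemma eq_geometric_dist (R : realType) (a b C q : R[i]) :
  0 <= C -> 0 <= q -> q < 1 ->
  (forall n, `|a - b| <= C * q ^+ n) -> a = b.
Proof.
move=> C0 q0 q1 h; apply/eqP; rewrite -subr_eq0 -normr_le0.
apply/negPn/negP => ab0.
have : 0 < `|a - b| by rewrite lt_def normr_ge0 andbT; apply: contra ab0 => /eqP->.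
move=> /(geometric_small C0 q0 q1) [N /(_ _ (leqnn N))].
by move=> /(le_lt_trans (h N)); rewrite ltxx.
Qed.

Lemma geometric_cauchy_limit (R : realType) (V : completeNormedModType R[i])
    (u : nat -> V) (C q : R[i]) :
  0 <= C -> 0 <= q -> q < 1 ->
  (forall m n, (m <= n)%N -> `|u m - u n| <= C * q ^+ m) ->
  exists l, forall n, `|u n - l| <= C * q ^+ n.
Proof.
move=> C0 q0 q1 h.
have : cvg (u @ \oo).
  apply: cauchy_cvg; apply: cauchy_exP => e e0.
  have [N HN] := geometric_small C0 q0 q1 e0.
  exists (u N); exists N => // n /= Nn.
  rewrite -ball_normE /=; apply: le_lt_trans (HN _ (leqnn N)); exact: h.
move=> /cvg_ex [l ul]; exists l => n; apply/ler_addgt0Pr => e e0.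
move: ul => /cvgrPdist_le /(_ _ e0) [N _ HN].
have /= := HN _ (leq_maxl N n) => h1.
have := h _ _ (leq_maxr N n) => h2.
rewrite (_ : u n - l = (u n - u (maxn N n)) - (l - u (maxn N n))); last first.
  by rewrite opprB addrA subrK.
exact: le_trans (ler_normB _ _) (lerD h2 h1).
Qed.

(* Taylor coefficients at 0 of (1 - x)^(-gamma). *)
Fixpoint negbin_coef (gamma k : nat) : nat :=
  if gamma is g.+1 then (\sum_(i < k.+1) negbin_coef g i)%N else (k == 0)%N.

Lemma negbin_coef_gt0 gamma k : (0 < gamma)%N -> (0 < negbin_coef gamma k)%N.
Proof.
case: gamma => // gamma _; elim: gamma k => [|g IH] k /=.
  by rewrite big_ord_recl.
rewrite big_ord_recl; apply: ltn_addr; exact: IH.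
Qed.

(** Induction on [gamma]: dividing by 1 - x replaces the coefficients by their partial sums, and
    summation by parts leaves only a boundary term of order k. On |x| <= 1/2 each division costs at
    most a factor 2. *)
Lemma negbin_tail (R : realType) (gamma k : nat) :
  exists2 M : R[i], 0 <= M & forall x : R[i], `|x| <= 2^-1 ->
  `|(1 - x) ^- gamma - \sum_(m < k) (negbin_coef gamma m)%:R * x ^+ m|
    <= M * `|x| ^+ k.
Proof.
elim: gamma => [|g [M M0 IH]].
  exists 1 => // x _; rewrite expr0 invr1 mul1r.
  case: k => [|k]; first by rewrite big_ord0 subr0 normr1.
  rewrite big_ord_recl /= mul1r expr0 big1 ?addr0 ?subrr ?normr0 ?exprn_ge0 //.
  by move=> i _; rewrite mul0r.
set c := negbin_coef g in IH *.
pose S j : R[i] := (\sum_(i < j) c i)%:R.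
have Sid x j : \sum_(m < j) (c m)%:R * x ^+ m =
    (1 - x) * (\sum_(m < j) S m.+1 * x ^+ m) + S j * x ^+ j.
  elim: j => [|j IHj]; first by rewrite !big_ord0 /S big_ord0 mulr0 mul0r addr0.
  have SS : S j.+1 = S j + (c j)%:R by rewrite /S big_ord_recr natrD.
  rewrite !big_ord_recr /= IHj SS exprS; ring.
exists (2 * (M + S k)) => [|x x2]; first by rewrite mulr_ge0 ?addr_ge0 ?ler0n.
have x1 : 2^-1 <= `|1 - x|.
  have := lerB_dist 1 x; rewrite normr1; apply: le_trans.
  by rewrite lerBrDr [leRHS]splitr div1r lerD2l.
have x10 : 1 - x != 0.
  by rewrite -normr_gt0; apply: lt_le_trans x1; rewrite invr_gt0 ltr0n.
rewrite -(ler_pM2l (x := `|1 - x|)) ?normr_gt0 // -normrM mulrBr.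
rewrite exprS invfM mulrA divff // mul1r.
rewrite (eq_bigr (fun m : 'I_k => S m.+1 * x ^+ m)) //.
rewrite (_ : _ - _ = ((1 - x) ^- g - \sum_(m < k) (c m)%:R * x ^+ m) + S k * x ^+ k);
  last by rewrite Sid; ring.
apply: le_trans (ler_normD _ _) _.
rewrite normrM normrX (ger0_norm (ler0n _ _)).
apply: le_trans (lerD (IH _ x2) (lexx _)) _.
rewrite -mulrDl !mulrA ler_wpM2r ?exprn_ge0 //.
rewrite -[leLHS]mul1r ler_wpM2r ?addr_ge0 ?ler0n //.
by move: x1; rewrite -ler_pdivrMr ?ltr0n // mul1r.
Qed.

(** * Reproducing kernel Hilbert spaces and their monomials *)

(** Cauchy-Schwarz: removing from f its projection onto g leaves a vector orthogonal to g, and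
    Pythagoras bounds the projection. *)
Lemma inner_le_norm (R : realType) (K : R[i] -> R[i] -> R[i]) (H : rkhs K) (f g : H) :
  `|inner H f g| <= `|f| * `|g|.
Proof.
have [->|g0] := eqVneq g 0; first by rewrite linear0r normr0 normr0 mulr0.
have gg0 : 0 < inner H g g by rewrite dnorm_gt0.
pose a := inner H f g / inner H g g; pose f1 := f - a *: g.
have f1g : inner H f1 g = 0.
  by rewrite linearBl linearZl_LR /= divfK ?subrr // gt_eqF.
have E : inner H f f = inner H f1 f1 + `|a| ^+ 2 * inner H g g.
  rewrite -dnormZ.
  have -> : inner H f f = inner H (f1 + a *: g) (f1 + a *: g) by rewrite subrK.
  have f1ag : inner H f1 (a *: g) = 0 by rewrite linearZr_LR /= f1g mulr0.
  by rewrite dnormD f1ag conjC0 !addr0.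
rewrite -(ler_pXn2r (n := 2)) ?nnegrE ?mulr_ge0 // exprMn !norm_inner E.
apply: le_trans (_ : `|a| ^+ 2 * inner H g g * inner H g g <= _); last first.
  by rewrite ler_wpM2r ?dnorm_ge0 // lerDr dnorm_ge0.
rewrite /a normrM normfV (ger0_norm (ltW gg0)) le_eqVlt; apply/orP; left.
by apply/eqP; field; rewrite gt_eqF.
Qed.

Section Rkhs.
Context (R : realType) (K : R[i] -> R[i] -> R[i]) (H : rkhs K).
Implicit Types (f g : H) (z w : R[i]).

Lemma evD f g z : disk z -> ev (f + g) z = ev f z + ev g z.
Proof. by move=> dz; rewrite -!reproducing // linearDl. Qed.

Lemma evB f g z : disk z -> ev (f - g) z = ev f z - ev g z.
Proof. by move=> dz; rewrite -!reproducing // linearBl. Qed.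

Lemma evZ a f z : disk z -> ev (a *: f) z = a * ev f z.
Proof. by move=> dz; rewrite -!reproducing // linearZl_LR. Qed.

Lemma ev_sum (I : finType) (f : I -> H) z : disk z ->
  ev (\sum_i f i) z = \sum_i ev (f i) z.
Proof.
move=> dz; apply: (big_morph (fun f => ev f z)) => [f1 f2|]; first exact: evD.
by rewrite -reproducing // linear0l.
Qed.

Lemma inner_suml (I : finType) (a : I -> R[i]) (f : I -> H) g :
  inner H (\sum_i a i *: f i) g = \sum_i a i * inner H (f i) g.
Proof.
rewrite (big_morph (fun h => inner H h g) (id1 := 0) (op1 := +%R)).
- by apply: eq_bigr => i _; rewrite linearZl_LR.
- by move=> f1 f2; rewrite linearDl.
- by rewrite linear0l.
Qed.

Lemma ev_le_norm f z : disk z -> `|ev f z| <= `|f| * `|kernel H z|.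
Proof. by move=> dz; rewrite -reproducing //; exact: inner_le_norm. Qed.

Lemma innerC f g : inner H f g = (inner H g f)^*.
Proof. by rewrite hermC /= expr0 mul1r. Qed.

Lemma inner_eq0C f g : inner H f g = 0 -> inner H g f = 0.
Proof. by move=> fg0; rewrite innerC fg0; exact: conjC0. Qed.

End Rkhs.

(** * Monomials in the space: existence, orthogonality and norms *)

Definition represents_monomial (R : realType) (K : R[i] -> R[i] -> R[i])
    (H : rkhs K) (k : nat) (e : H) : Prop :=
  forall z, disk z -> ev e z = z ^+ k.

Section Monomials.
Context (R : realType) (gamma : nat) (gamma_ge1 : (1 <= gamma)%N).
Context (H : rkhs (@kernel_gamma R gamma)).
Let c k : R[i] := (negbin_coef gamma k)%:R.
Let c_ge1 k : 1 <= c k.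
Proof. by rewrite /c ler1n negbin_coef_gt0. Qed.
Let c_gt0 k : 0 < c k.
Proof. exact: lt_le_trans ltr01 (c_ge1 k). Qed.

(** The exponent starts at 1, so that [radius n * z] stays in the range |x| <= 1/2 of
    [negbin_tail]. *)
Let radius n : R[i] := 2^-1 ^+ n.+1.
Let radius_gt0 n : 0 < radius n.
Proof. by rewrite exprn_gt0 // invr_gt0 ltr0n. Qed.
Let radius_half n : radius n <= 2^-1.
Proof.
rewrite /radius exprS ler_piMr ?invr_ge0 ?ler0n // exprn_ile1 ?invr_ge0 ?ler0n //.
by rewrite invf_le1 ?ltr0n // ler1n.
Qed.
Let half_lt1 : 2^-1 < 1 :> R[i].
Proof. by rewrite invf_lt1 ?ltr0n // ltr1n. Qed.
Let radius_disk n : disk (radius n).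
Proof.
by rewrite /disk /= ger0_norm ?(ltW (radius_gt0 n)) // (le_lt_trans (radius_half n)).
Qed.
Let radius_real n : (radius n)^* = radius n.
Proof. by apply: ger0_conjc; apply: ltW. Qed.

(* The approximants of z^k are K_r minus the part of its Taylor expansion of
   degree less than k, divided by c_k r^k. Being orthogonal to the lower
   monomials, their Gram matrix only involves the tail of (1 - x)^(-gamma) at
   x = r r', so that it converges and they form a Cauchy sequence. *)
Lemma monomial_approx k (g : nat -> H) :
  (forall m, (m < k)%N -> represents_monomial m (g m)) ->
  (forall m l, (m < k)%N -> (l < k)%N -> inner H (g m) (g l) = (m == l)%:R / c m) ->
  exists2 f : nat -> H, forall n l, (l < k)%N -> inner H (f n) (g l) = 0 &
  exists2 M : R[i], 0 <= M &
  [/\ forall n z, disk z -> `|ev (f n) z - z ^+ k| <= M * 2^-1 ^+ n,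
      forall m n, (m <= n)%N -> `|f m - f n| <= M * 2^-1 ^+ m &
      forall n e, represents_monomial k e -> (forall l, (l < k)%N -> inner H e (g l) = 0) ->
      inner H (f n) e = (c k)^-1].
Proof.
move=> gmono gortho.
pose D n := kernel H (radius n) - \sum_(m < k) (c m * radius n ^+ m) *: g m.
pose f n := (c k * radius n ^+ k)^-1 *: D n.
have ck0 n : 0 < c k * radius n ^+ k by apply: mulr_gt0 => //; apply: exprn_gt0.
have innerDg n l : (l < k)%N -> inner H (D n) (g l) = 0.
  move=> lk; rewrite linearBl /= innerC reproducing // gmono // rmorphXn /=.
  rewrite radius_real inner_suml (bigD1 (Ordinal lk)) //= big1 => [|m ml].
    rewrite gortho // eqxx addr0 mulr1n mul1r.
    by rewrite mulrAC divff ?gt_eqF // mul1r subrr.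
  rewrite gortho // (_ : (m == l :> nat) = false) ?mul0r ?mulr0 //.
  by apply/negbTE; apply: contra ml => /eqP ml; apply/eqP/val_inj.
exists f => [n l lk|]; first by rewrite linearZl_LR /= innerDg // mulr0.
(* Order [k.+1] rather than [k] exposes the leading term c_k x^k of the tail [T]. *)
have [M M0 HM] := @negbin_tail R gamma k.+1.
pose T (x : R[i]) := (1 - x) ^- gamma - \sum_(m < k) c m * x ^+ m.
have Tle x : `|x| <= 2^-1 -> `|T x - c k * x ^+ k| <= M * `|x| ^+ k.+1.
  by move=> x2; apply: le_trans (HM _ x2); rewrite big_ord_recr /= opprD addrA.
have evD n z : disk z -> ev (D n) z = T (radius n * z).
  move=> dz; rewrite evB // ev_kernel // ev_sum // /T /kernel_gamma radius_real.
  congr (_ - _); apply: eq_bigr => m _.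
  by rewrite evZ // gmono // exprMn mulrA.
have innerDD m n : inner H (D m) (D n) = T (radius m * radius n).
  rewrite {2}/D linearBr /= reproducing // evD // linear_sumr big1 ?subr0 // => i _.
  by rewrite linearZr_LR /= innerDg // mulr0.
have conjc_scal n : (c k * radius n ^+ k)^-1^* = (c k * radius n ^+ k)^-1.
  by apply: ger0_conjc; rewrite invr_ge0 ltW.
have half_small x y : `|x| <= 2^-1 -> `|y| < 1 -> `|x * y| <= 2^-1.
  by move=> x2 y1; rewrite normrM -[leRHS]mulr1 ler_pM // ltW.
have normr_radius n : `|radius n| = radius n by rewrite ger0_norm // ltW.
have scaledT n y : `|y| < 1 ->
    `|(c k * radius n ^+ k)^-1 * T (radius n * y) - y ^+ k| <=
    M * `|y| ^+ k.+1 * radius n.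
  move=> y1.
  have -> : (c k * radius n ^+ k)^-1 * T (radius n * y) - y ^+ k =
      (c k * radius n ^+ k)^-1 * (T (radius n * y) - c k * (radius n * y) ^+ k).
    rewrite [RHS]mulrBr; congr (_ - _); rewrite exprMn (mulrA (c k)) mulrA mulVf ?mul1r //.
    by rewrite gt_eqF.
  rewrite normrM ger0_norm ?invr_ge0 ?(ltW (ck0 n)) // mulrC ler_pdivrMr //.
  apply: le_trans (Tle _ _) _; first by rewrite half_small ?normr_radius.
  rewrite normrM normr_radius exprMn exprS [leRHS](_ : _ =
    c k * (M * (radius n * radius n ^+ k * `|y| ^+ k.+1))); last by ring.
  have r0 := ltW (radius_gt0 n).
  apply: ler_peMl => //; apply: mulr_ge0 => //; apply: mulr_ge0; last exact: exprn_ge0.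
  by apply: mulr_ge0 => //; exact: exprn_ge0.
(* Every Gram entry tends to 1/c_k, the scaled leading term of [T]. *)
have innerff m n : `|inner H (f m) (f n) - (c k)^-1| <= M * (radius m * radius n).
  rewrite linearZl_LR linearZr_LR /= conjc_scal innerDD.
  have rn0 := ltW (radius_gt0 n); have rm0 := ltW (radius_gt0 m).
  set X := (X in `|X|).
  have -> : X = (c k * radius n ^+ k)^-1 *
      ((c k * radius m ^+ k)^-1 * T (radius m * radius n) - radius n ^+ k).
    rewrite [RHS]mulrBr /X; congr (_ - _); first by rewrite mulrCA.
    by rewrite invfM -mulrA mulVf ?mulr1 // gt_eqF // exprn_gt0.
  rewrite normrM ger0_norm ?invr_ge0 ?(ltW (ck0 n)) // mulrC ler_pdivrMr //.
  apply: le_trans (scaledT m _ (radius_disk n)) _; rewrite normr_radius.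
  rewrite exprS [leRHS](_ : _ =
    c k * (M * (radius n * radius n ^+ k) * radius m)); last by ring.
  apply: ler_peMl => //; apply: mulr_ge0 => //; apply: mulr_ge0 => //.
  by apply: mulr_ge0 => //; exact: exprn_ge0.
(* [innerff] bounds squared distances, by 4 M r^2 with r = [radius m]. Since M <= (M + 1)^2, the
   constant [M + 1] bounds the distances without a square root. *)
exists (M + 1); first by rewrite addr_ge0.
have radius_le n : radius n <= 2^-1 ^+ n.
  by rewrite /radius exprS ler_piMl ?exprn_ge0 ?invr_ge0 ?ler0n // ltW.
split.
- move=> n z dz; rewrite evZ // evD //.
  apply: le_trans (scaledT n z dz) _.
  apply: ler_pM => //; [by apply: mulr_ge0 => //; exact: exprn_ge0|exact: ltW|].
  apply: le_trans (_ : M <= _); last by rewrite lerDl.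
  by apply: ler_piMr => //; apply: exprn_ile1 => //; exact: (ltW dz).
- move=> m n mn.
  have rmn : radius n <= radius m.
    have half0 : 0 <= 2^-1 :> R[i] by rewrite invr_ge0 ler0n.
    exact: (ler_wiXn2l half0 (ltW half_lt1)).
  have rn0 := ltW (radius_gt0 n); have rm0 := ltW (radius_gt0 m).
  have -> : 2^-1 ^+ m = 2 * radius m.
    by rewrite /radius exprS mulrA divff ?mul1r // pnatr_eq0.
  have M10 : 0 <= M + 1 by rewrite addr_ge0.
  rewrite -(ler_pXn2r (n := 2)) ?nnegrE //; last first.
    by apply: mulr_ge0 => //; apply: mulr_ge0.
  rewrite norm_inner linearBl /= !linearBr /=.
  set a := inner H (f m) (f m); set b := inner H (f m) (f n).
  set d := inner H (f n) (f m); set e := inner H (f n) (f n).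
  have -> : a - b - (d - e) = (a - (c k)^-1) - (b - (c k)^-1) -
     ((d - (c k)^-1) - (e - (c k)^-1)) by ring.
  rewrite -[leLHS]ger0_norm; last first.
    have := dnorm_ge0 (inner H) (f m - f n).
    rewrite linearBl /= !linearBr /= -/a -/b -/d -/e; congr (_ <= _); ring.
  apply: le_trans (ler_normB _ _) _.
  apply: le_trans (lerD (ler_normB _ _) (ler_normB _ _)) _.
  apply: le_trans (lerD (lerD (innerff _ _) (innerff _ _))
    (lerD (innerff _ _) (innerff _ _))) _.
  have le4 x y : 0 <= x -> x <= radius m -> 0 <= y -> y <= radius m ->
      M * (x * y) <= M * (radius m * radius m).
    by move=> *; apply: ler_wpM2l => //; apply: ler_pM.
  apply: le_trans (lerD (lerD (le4 _ _ _ _ _ _) (le4 _ _ _ _ _ _))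
    (lerD (le4 _ _ _ _ _ _) (le4 _ _ _ _ _ _))) _ => //.
  rewrite -subr_ge0 [X in 0 <= X](_ : _ = 4 * ((M ^+ 2 + M + 1) * radius m ^+ 2));
    last by ring.
  apply: mulr_ge0; rewrite ?ler0n //; apply: mulr_ge0; last exact: exprn_ge0.
  by rewrite !addr_ge0 // exprn_ge0.
- move=> n e emono eortho; rewrite linearZl_LR /= linearBl /= inner_suml big1 ?subr0.
    rewrite innerC reproducing // emono // rmorphXn /= radius_real.
    by rewrite invfM -mulrA mulVf ?mulr1 // gt_eqF // exprn_gt0.
  by move=> i _; rewrite (inner_eq0C (eortho _ _)) // mulr0.
Qed.

End Monomials.

Section MonomialBasis.
Context (R : realType) (gamma : nat) (gamma_ge1 : (1 <= gamma)%N).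
Context (H : rkhs (@kernel_gamma R gamma)).
Let c k : R[i] := (negbin_coef gamma k)%:R.

(** The approximants built from the lower monomials converge in norm; their limit inherits values
    and orthogonality because evaluations and inner products are controlled by the norm. *)
Lemma monomial_exists k : exists e : H,
  [/\ represents_monomial k e, inner H e e = (c k)^-1 &
      forall l e', (l < k)%N -> represents_monomial l e' -> inner H e e' = 0].
Proof.
elim/ltn_ind: k => k IH.
have /choice [g gP] : forall m, exists e : H, (m < k)%N ->
  [/\ represents_monomial m e, inner H e e = (c m)^-1 &
      forall l e', (l < m)%N -> represents_monomial l e' -> inner H e e' = 0].
  move=> m; case: (ltnP m k) => [mk|_]; last by exists 0.
  by have [e eP] := IH _ mk; exists e.
have gmono m : (m < k)%N -> represents_monomial m (g m) by move=> /gP[].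
have gortho m l : (m < k)%N -> (l < k)%N -> inner H (g m) (g l) = (m == l)%:R / c m.
  move=> mk lk; have [ml|lm|<-] := ltngtP m l; last by have [_ -> _] := gP _ mk; rewrite mul1r.
    rewrite mul0r; apply: inner_eq0C; have [_ _ /(_ m)] := gP _ lk; apply => //.
    exact: gmono.
  by rewrite mul0r; have [_ _ /(_ l)] := gP _ mk; apply => //; exact: gmono.
have [f fg [M M0 [fev fcauchy fe]]] := monomial_approx gamma_ge1 gmono gortho.
have half0 : 0 <= 2^-1 :> R[i] by rewrite invr_ge0 ler0n.
have half1 : 2^-1 < 1 :> R[i] by rewrite invf_lt1 ?ltr0n // ltr1n.
have [e eP] := geometric_cauchy_limit M0 half0 half1 fcauchy.
have emono : represents_monomial k e.
  move=> z dz; pose B := M * `|kernel H z| + M.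
  apply: (@eq_geometric_dist _ _ _ B 2^-1) => // [|n].
    by rewrite addr_ge0 // mulr_ge0.
  rewrite (_ : _ - _ = (ev (f n) z - z ^+ k) - ev (f n - e) z); last first.
    by rewrite evB //; ring.
  apply: le_trans (ler_normB _ _) _; rewrite /B mulrDl addrC.
  apply: lerD; last exact: fev.
  apply: le_trans (ev_le_norm _ dz) _; rewrite mulrAC.
  by apply: ler_wpM2r.
have eortho l e' : (l < k)%N -> represents_monomial l e' -> inner H e e' = 0.
  move=> lk mono'; have -> : e' = g l.
    by apply: ev_inj => z dz; rewrite mono' // gmono.
  apply: (@eq_geometric_dist _ _ _ (M * `|g l|) 2^-1) => // [|n].
    by rewrite mulr_ge0.
  have -> : inner H e (g l) = - inner H (f n - e) (g l).
    by rewrite linearBl /= fg // sub0r opprK.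
  rewrite subr0 normrN.
  by apply: le_trans (inner_le_norm _ _) _; rewrite mulrAC ler_wpM2r.
exists e; split => //.
apply: (@eq_geometric_dist _ _ _ (M * `|e|) 2^-1) => // [|n].
  by rewrite mulr_ge0.
(* The approximants pair with [e] to exactly 1/c_k, so the distance from [f n] to [e] controls the
   error. *)
rewrite -(fe n e) // => [|l lk]; last exact: eortho (gmono _ lk).
rewrite distrC -linearBl /=.
by apply: le_trans (inner_le_norm _ _) _; rewrite mulrAC ler_wpM2r.
Qed.

(* The uniform bound on the functions z^m F makes the geometric series for
   F / (1 - b z) converge in norm. *)
Definition shift_bounded (F : R[i] -> R[i]) : Prop :=
  exists2 C : R[i], 0 <= C & exists e : nat -> H,
    (forall m z, disk z -> ev (e m) z = z ^+ m * F z) /\ forall m, `|e m| <= C.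

Lemma shift_bounded1 : shift_bounded (fun=> 1).
Proof.
exists 1 => //; have /choice [e eP] := monomial_exists; exists e; split.
  by move=> m z dz; have [-> //] := eP m; rewrite mulr1.
move=> m; have [_ ee _] := eP m.
rewrite -(ler_pXn2r (n := 2)) ?nnegrE // norm_inner ee expr1n.
by rewrite invf_le1 ?ltr0n ?ler1n negbin_coef_gt0.
Qed.

Lemma shift_boundedX F : shift_bounded F -> shift_bounded (fun z => z * F z).
Proof.
move=> [C C0 [e [eF eC]]]; exists C => //; exists (fun m => e m.+1); split=> // m z dz.
by rewrite eF // exprSr mulrA.
Qed.

Lemma shift_bounded_lin a F G : shift_bounded F -> shift_bounded G ->
  shift_bounded (fun z => F z + a * G z).
Proof.
move=> [C C0 [e [eF eC]]] [D D0 [f [fG fD]]].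
exists (C + `|a| * D); first by rewrite addr_ge0 // mulr_ge0.
exists (fun m => e m + a *: f m); split=> [m z dz|m].
  by rewrite evD // evZ // eF // fG //; ring.
apply: le_trans (ler_normD _ _) _; rewrite normrZ.
by apply: lerD => //; apply: ler_wpM2l.
Qed.

(** The function z^k F / (1 - b z) is the sum of the b^i z^(k+i) F, a series whose terms have norm
    at most C |b|^i; hence the new bound C / (1 - |b|). *)
Lemma shift_bounded_div b F : `|b| < 1 -> shift_bounded F ->
  shift_bounded (fun z => F z / (1 - b * z)).
Proof.
move=> b1 [C C0 [e [eF eC]]].
pose S k n := \sum_(i < n) b ^+ i *: e (k + i)%N.
have b1' : 0 < 1 - `|b| by rewrite subr_gt0.
pose D := C / (1 - `|b|).
have D0 : 0 <= D by rewrite divr_ge0 // ltW.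
have Scauchy k m n : (m <= n)%N -> `|S k m - S k n| <= D * `|b| ^+ m.
  (* The sharper bound with |b|^m - |b|^n telescopes, which lets the induction on [n] go through. *)
  move=> mn; apply: le_trans (_ : D * (`|b| ^+ m - `|b| ^+ n) <= _); last first.
    by apply: ler_wpM2l => //; rewrite gerBl exprn_ge0.
  elim: n mn => [|n IHn].
    by rewrite leqn0 => /eqP->; rewrite !subrr mulr0 normr0.
  rewrite leq_eqVlt ltnS => /predU1P[->|/IHn mn]; first by rewrite !subrr mulr0 normr0.
  rewrite /S big_ord_recr /= opprD addrA.
  apply: le_trans (ler_normB _ _) _.
  rewrite (_ : D * (_ - _) = D * (`|b| ^+ m - `|b| ^+ n) + `|b| ^+ n * C); last first.
    by rewrite /D exprS; field; rewrite gt_eqF.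
  by apply: lerD => //; rewrite normrZ normrX ler_wpM2l // exprn_ge0.
have Sev k n z : disk z ->
    (1 - b * z) * ev (S k n) z = z ^+ k * F z * (1 - (b * z) ^+ n).
  move=> dz; rewrite /S ev_sum //; elim: n => [|n IHn].
    by rewrite big_ord0 expr0 subrr !mulr0.
  rewrite big_ord_recr /= mulrDr IHn evZ // eF // exprD exprS !exprMn; ring.
have /choice [l lP] : forall k, exists l, forall n, `|S k n - l| <= D * `|b| ^+ n.
  move=> k; exact: geometric_cauchy_limit (Scauchy k).
exists D => //; exists l; split=> [k z dz|k]; last first.
  (* At n = 0 the partial sum is empty and the rate bounds the norm of the limit itself. *)
  by have := lP k 0%N; rewrite /S big_ord0 sub0r normrN expr0 mulr1.
have bz : 1 - b * z != 0.
  rewrite -normr_gt0; apply: lt_le_trans (lerB_dist _ _).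
  rewrite normr1 subr_gt0 normrM -[ltRHS]mulr1.
  by apply: ltr_pM.
apply: (mulfI bz); rewrite [RHS](_ : _ = z ^+ k * F z); last by field.
pose B := `|1 - b * z| * (D * `|kernel H z|) + `|z ^+ k * F z|.
apply: (@eq_geometric_dist _ _ _ B `|b|) => // [|n].
  by apply: addr_ge0 => //; apply: mulr_ge0 => //; exact: mulr_ge0.
rewrite (_ : _ - _ = - ((1 - b * z) * ev (S k n - l k) z) - z ^+ k * F z * (b * z) ^+ n);
  last first.
  by rewrite evB // mulrBr Sev //; ring.
apply: le_trans (ler_normB _ _) _; rewrite normrN /B [leRHS]mulrDl; apply: lerD.
  rewrite normrM -mulrA; apply: ler_wpM2l => //.
  apply: le_trans (ev_le_norm _ dz) _; rewrite mulrAC.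
  by apply: ler_wpM2r.
rewrite normrM; apply: ler_wpM2l => //; rewrite normrX normrM exprMn.
apply: ler_piMr; first exact: exprn_ge0.
by apply: exprn_ile1 => //; exact: (ltW dz).
Qed.

Lemma shift_bounded_exp a b n : `|b| < 1 ->
  shift_bounded (fun z => ((1 - a * z) / (1 - b * z)) ^+ n).
Proof.
move=> b1; elim: n => [|n IHn]; first exact: shift_bounded1.
have [C C0 [e [eF eC]]] := shift_bounded_div b1
  (shift_bounded_lin (- a) IHn (shift_boundedX IHn)).
exists C => //; exists e; split=> // m z dz.
by rewrite eF // exprS; ring.
Qed.

End MonomialBasis.

(** * The Berezin symbol *)

(** The squared moduli differ by (1 - |x|^2) (1 - |y|^2). *)
Lemma moebius_dist (R : realType) (x y : R[i]) :
  disk x -> disk y -> `|x - y| < `|1 - y^* * x|.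
Proof.
rewrite /disk /= => x1 y1; rewrite -(ltr_pXn2r (n := 2)) ?nnegrE //.
rewrite -subr_gt0 !sqr_normc.
have -> : (1 - y^* * x) * (1 - y^* * x)^* - (x - y) * (x - y)^* =
    (1 - x * x^*) * (1 - y * y^*).
  rewrite !rmorphB rmorphM /= rmorph1.
  by rewrite (_ : y^*^* = y); [ring|exact: conjcK].
by rewrite -!sqr_normc mulr_gt0 // subr_gt0 expr_lt1.
Qed.

Lemma one_sub_conj_neq0 (R : realType) (x y : R[i]) :
  disk x -> disk y -> 1 - y^* * x != 0.
Proof. by move=> dx dy; rewrite -normr_gt0 (le_lt_trans _ (moebius_dist dx dy)). Qed.

Lemma moebius_disk (R : realType) (alpha z : R[i]) :
  disk alpha -> disk z -> disk (moebius alpha z).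
Proof.
move=> da dz; rewrite /disk /moebius /= normrM normfV.
by rewrite ltr_pdivrMr ?mul1r ?moebius_dist // normr_gt0 one_sub_conj_neq0.
Qed.

Section Symbol.
Context (R : realType) (gamma : nat) (gamma_ge1 : (1 <= gamma)%N).
Context (H : rkhs (@kernel_gamma R gamma)).
Context (alpha : R[i]) (alpha_disk : disk alpha).

(** Here [b] is the conjugate of the value at w of the inverse automorphism, [moebius (- alpha)],
    hence lies in the disk. The element [e 0] is the unshifted function. *)
Lemma kernel_moebius_exists w : disk w -> exists g : H,
  forall z, disk z -> ev g z = ev (kernel H w) (moebius alpha z).
Proof.
move=> dw; pose b := (alpha^* + w^*) / (1 + w^* * alpha).
have dNa : disk (- alpha) by rewrite /disk /= normrN.
have wa0 : 1 + w^* * alpha != 0.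
  by have := one_sub_conj_neq0 dNa dw; rewrite mulrN opprK.
have b1 : `|b| < 1.
  rewrite /b normrM normfV ltr_pdivrMr ?normr_gt0 // mul1r.
  have -> : alpha^* + w^* = (w - - alpha)^* by rewrite opprK rmorphD addrC.
  have -> : 1 + w^* * alpha = (1 - (- alpha)^* * w)^*.
    rewrite rmorphB rmorphM rmorphN rmorphN /= rmorph1 (_ : alpha^*^* = alpha).
      by rewrite mulNr opprK mulrC.
    exact: conjcK.
  by rewrite !normcJ; exact: moebius_dist.
have [C C0 [e [eF _]]] :=
  shift_bounded_exp gamma_ge1 H (alpha^*) gamma b1.
exists ((1 + w^* * alpha) ^- gamma *: e 0%N) => z dz.
rewrite ev_kernel //; last exact: moebius_disk.
rewrite evZ // eF // expr0 mul1r /kernel_gamma -exprVn -exprMn -exprVn; congr (_ ^+ _).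
have bz : 1 - b * z != 0.
  rewrite -normr_gt0; apply: lt_le_trans (lerB_dist _ _).
  by rewrite normr1 subr_gt0 normrM -[ltRHS]mulr1 ltr_pM.
have az := one_sub_conj_neq0 dz alpha_disk.
have bz' : 1 + w^* * alpha - (alpha^* + w^*) * z != 0.
  have -> : 1 + w^* * alpha - (alpha^* + w^*) * z = (1 + w^* * alpha) * (1 - b * z).
    by rewrite /b; field.
  by rewrite mulf_neq0.
have -> : 1 - w^* * moebius alpha z =
    (1 + w^* * alpha) * (1 - b * z) / (1 - alpha^* * z).
  by rewrite /b /moebius; field; rewrite wa0 az.
by field; rewrite az bz wa0.
Qed.

(** The [get] in [comp_op] obeys its specification once a witness exists, which
    [kernel_moebius_exists] supplies. *)
Lemma comp_op_moebius_kernel w z : disk w -> disk z ->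
  ev (comp_op (H := H) (moebius alpha) (normalized_kernel H w)) z =
  `|kernel H w|^-1 * kernel_gamma gamma w (moebius alpha z).
Proof.
move=> dw; move: z.
have [g gP] := kernel_moebius_exists dw.
have E : exists h : H, forall z, disk z ->
    ev h z = ev (normalized_kernel H w) (moebius alpha z).
  by exists (`|kernel H w|^-1 *: g) => z dz; rewrite !evZ ?gP //; apply: moebius_disk.
move=> z dz; rewrite (getPex E) // evZ ?ev_kernel //; exact: moebius_disk.
Qed.

Lemma berezin_moebius w : disk w ->
  berezin_symbol (comp_op (H := H) (moebius alpha)) w =
  ((1 - w^* * w) / (1 - w^* * moebius alpha w)) ^+ gamma.
Proof.
move=> dw; rewrite /berezin_symbol {2}/normalized_kernel linearZr_LR /=.
rewrite reproducing // comp_op_moebius_kernel //.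
have -> : (`|kernel H w|^-1)^* = `|kernel H w|^-1 by apply: ger0_conjc; rewrite invr_ge0.
rewrite mulrA -expr2 exprVn norm_inner reproducing // ev_kernel // /kernel_gamma invrK.
by rewrite -exprVn -exprMn.
Qed.

End Symbol.

(** * Non-convexity *)

(** As p > 0, the argument is atan (q / p) and the modulus is p divided by its cosine; the powers
    follow from the addition formulas. *)
Lemma polar_pow (R : realType) (p q : R) : 0 < p -> exists2 rho : R, 0 < rho &
  rho ^+ 2 = p ^+ 2 + q ^+ 2 /\ forall n, (p +i* q) ^+ n =
    (rho ^+ n * cos (n%:R * atan (q / p))) +i* (rho ^+ n * sin (n%:R * atan (q / p))).
Proof.
move=> p0; set t := atan (q / p).
have cost_gt0 : 0 < cos t by rewrite cos_gt0_pihalf // atan_gtNpi2 atan_ltpi2.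
have sinE : sin t = q / p * cos t.
  by rewrite -{1}[q / p]atanK -/t /tan mulfVK // gt_eqF.
exists (p / cos t); first exact: divr_gt0.
have qE : q = p / cos t * sin t by rewrite sinE; field; rewrite !gt_eqF.
have pE : p = p / cos t * cos t by rewrite mulfVK // gt_eqF.
set rho := p / cos t in pE qE *; split.
  rewrite [in RHS]pE qE -[LHS]mulr1 -(cos2Dsin2 t); ring.
elim=> [|n IHn]; first by rewrite !mul0r cos0 sin0 !expr0 mulr0 mulr1.
have step : p +i* q = (rho * cos t) +i* (rho * sin t) by rewrite -pE -qE.
rewrite exprS IHn step -natr1 mulrDl mul1r cosD sinD exprS.
by apply/eqP; rewrite eq_complex /=; apply/andP; split; apply/eqP; ring.
Qed.

Section Range.
Context (R : realType).
Implicit Types (A x y : R).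

(* For w = alpha (x + i y), A = |alpha|^2 and s = 1 - |w|^2, the Berezin symbol
   at w is the gamma-th power of s (1 - A (x + i y)) / (s - 2 i A y); this
   quotient is symbol_scale * (symbol_re + i symbol_im). *)
Definition symbol_scale A x y : R :=
  (1 - A * (x ^+ 2 + y ^+ 2)) /
  ((1 - A * (x ^+ 2 + y ^+ 2)) ^+ 2 + 4 * A ^+ 2 * y ^+ 2).
Definition symbol_re A x y : R :=
  (1 - A * (x ^+ 2 + y ^+ 2)) * (1 - A * x) + 2 * A ^+ 2 * y ^+ 2.
Definition symbol_im A x y : R :=
  A * y * (1 - 2 * A * x + A * (x ^+ 2 + y ^+ 2)).
Definition symbol_root A x y : R[i] :=
  (symbol_scale A x y * symbol_re A x y) +i* (symbol_scale A x y * symbol_im A x y).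

Context (A : R) (A_gt0 : 0 < A) (A_lt1 : A < 1).

Lemma symbol_scale_gt0 x y : A * (x ^+ 2 + y ^+ 2) < 1 -> 0 < symbol_scale A x y.
Proof.
move=> s; apply: divr_gt0; rewrite ?subr_gt0 //.
rewrite ltr_pwDl ?exprn_gt0 ?subr_gt0 // -mulrA.
by rewrite mulr_ge0 ?ler0n // mulr_ge0 ?sqr_ge0.
Qed.

(** A x is the real part of conj(alpha) w, a number of modulus below 1. *)
Lemma symbol_domain_re_lt1 x y : A * (x ^+ 2 + y ^+ 2) < 1 -> A * x < 1.
Proof.
move=> s; rewrite ltNge; apply/negP => Ax.
have Ax1 : 1 <= (A * x) ^+ 2 by rewrite exprn_ege1.
have : A * (A * (x ^+ 2 + y ^+ 2)) < A by rewrite gtr_pMr.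
rewrite (_ : A * _ = (A * x) ^+ 2 + A ^+ 2 * y ^+ 2); last by ring.
have y2 := mulr_ge0 (sqr_ge0 A) (sqr_ge0 y); move: A_lt1 => A1 h; lra.
Qed.

Lemma symbol_re_gt0 x y : A * (x ^+ 2 + y ^+ 2) < 1 -> 0 < symbol_re A x y.
Proof.
move=> s; have Ax := symbol_domain_re_lt1 s; rewrite /symbol_re ltr_pwDl //.
  by rewrite mulr_gt0 // subr_gt0.
by rewrite -mulrA mulr_ge0 ?ler0n // mulr_ge0 ?sqr_ge0.
Qed.

(** The expression is 1 - A plus A |x + i y - 1|^2. It makes the sign of [symbol_im] that of y. *)
Lemma symbol_im_factor_gt0 x y : 0 < 1 - 2 * A * x + A * (x ^+ 2 + y ^+ 2).
Proof.
rewrite (_ : _ + _ = (1 - A) + (A * (x - 1) ^+ 2 + A * y ^+ 2)); last by ring.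
by rewrite ltr_pwDl ?subr_gt0 // addr_ge0 // mulr_ge0 ?sqr_ge0 // ltW.
Qed.

Lemma symbol_im_gt0 x y : 0 < y -> 0 < symbol_im A x y.
Proof. by move=> y0; rewrite !mulr_gt0 // symbol_im_factor_gt0. Qed.

Lemma symbol_rootN x y : symbol_root A x (- y) = (symbol_root A x y)^*.
Proof.
rewrite /symbol_root /symbol_scale /symbol_re /symbol_im sqrrN /=.
by congr (_ +i* _); ring.
Qed.

(** The quotient is the tangent of the argument. With denominators cleared, the equation along the
    segment from the origin is polynomial in the parameter, with value -c at 0 and a positive value
    at 1. *)
Lemma symbol_ray_ivt x y c : 0 < c -> c < symbol_im A x y / symbol_re A x y ->
  A * (x ^+ 2 + y ^+ 2) < 1 -> exists x' y',
  A * (x' ^+ 2 + y' ^+ 2) < 1 /\ symbol_im A x' y' / symbol_re A x' y' = c.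
Proof.
move=> c0 cxy s; have re0 := symbol_re_gt0 s.
pose X := x *: 'X : {poly R}; pose Y := y *: 'X : {poly R}.
pose p : {poly R} := A%:P * Y * (1 - 2 * A%:P * X + A%:P * (X ^+ 2 + Y ^+ 2))
  - c%:P * ((1 - A%:P * (X ^+ 2 + Y ^+ 2)) * (1 - A%:P * X) + 2 * A%:P ^+ 2 * Y ^+ 2).
have pE t : p.[t] = symbol_im A (t * x) (t * y) - c * symbol_re A (t * x) (t * y).
  rewrite /p /X /Y /symbol_im /symbol_re !(hornerE, horner_exp) /=; ring.
have [||t /andP[t0 t1]] := @poly_ivt _ p 0 1; first exact: ler01.
  rewrite !pE !mul0r !mul1r /symbol_im /symbol_re; apply/andP; split; first by nra.
  by move: cxy; rewrite ltr_pdivlMr // /symbol_im /symbol_re => h; lra.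
rewrite rootE pE subr_eq0 => /eqP h; exists (t * x), (t * y).
have s' : A * ((t * x) ^+ 2 + (t * y) ^+ 2) < 1.
  apply: le_lt_trans s; apply: ler_wpM2l; first exact: ltW.
  rewrite !exprMn -mulrDr ler_piMl ?addr_ge0 ?sqr_ge0 //.
  by rewrite exprn_ile1.
split => //; rewrite h mulfK // gt_eqF //; exact: symbol_re_gt0.
Qed.

End Range.

Lemma symbol_root_real (R : realType) (A x : R) : A * x ^+ 2 < 1 ->
  symbol_root A x 0 = (1 - A * x)%:C.
Proof.
move=> s; rewrite /symbol_root /symbol_scale /symbol_re /symbol_im.
have s0 : 1 - A * x ^+ 2 != 0 by rewrite gt_eqF // subr_gt0.
rewrite expr0n /= !mulr0 !mul0r !addr0 mulr0; congr (_ +i* _).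
by field.
Qed.

Lemma symbol_modulus (R : realType) (A x y : R) :
  let s := 1 - A * (x ^+ 2 + y ^+ 2) in s ^+ 2 + 4 * A ^+ 2 * y ^+ 2 != 0 ->
  (symbol_scale A x y * symbol_re A x y) ^+ 2 +
    (symbol_scale A x y * symbol_im A x y) ^+ 2 =
  s ^+ 2 * ((1 - A * x) ^+ 2 + A ^+ 2 * y ^+ 2) / (s ^+ 2 + 4 * A ^+ 2 * y ^+ 2).
Proof.
move=> s d0; rewrite /symbol_scale /symbol_re /symbol_im -/s.
(* Once the imaginary part is written through s, the identity holds for s a free variable. *)
have -> : 1 - 2 * A * x + A * (x ^+ 2 + y ^+ 2) = 2 * (1 - A * x) - s.
  by rewrite /s; ring.
by move: d0; move: s => s d0; field.
Qed.

(** The set enters only through its coordinates, and convexity is spelled out in C, which separates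
    the geometry from the operator. *)
Lemma symbol_range_not_convex (R : realType) (r : R) (gamma : nat) (S : R[i] -> Prop) :
  0 < r -> r < 1 -> (0 < gamma)%N ->
  (forall u, S u <-> exists x y, r ^+ 2 * (x ^+ 2 + y ^+ 2) < 1 /\
     u = symbol_root (r ^+ 2) x y ^+ gamma) ->
  ~ (forall u v (t : R), 0 <= t -> t <= 1 -> S u -> S v ->
     S (t%:C * u + (1 - t)%:C * v)).
Proof.
move=> r0 r1 gamma0 SE Sconv; set A := r ^+ 2 in SE.
have A0 : 0 < A by rewrite exprn_gt0.
have A1 : A < 1 by rewrite expr_lt1 // ltW.
have polar x y : A * (x ^+ 2 + y ^+ 2) < 1 -> exists2 rho, 0 < rho &
    rho ^+ 2 = (symbol_scale A x y * symbol_re A x y) ^+ 2 +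
               (symbol_scale A x y * symbol_im A x y) ^+ 2 /\
    symbol_root A x y ^+ gamma =
      (rho ^+ gamma * cos (gamma%:R * atan (symbol_im A x y / symbol_re A x y))) +i*
      (rho ^+ gamma * sin (gamma%:R * atan (symbol_im A x y / symbol_re A x y))).
  move=> s; have k0 := symbol_scale_gt0 s.
  have p0 := symbol_re_gt0 A0 A1 s.
  have [rho rho0 [rho2 rhoE]] :=
    polar_pow (symbol_scale A x y * symbol_im A x y) (mulr_gt0 k0 p0).
  exists rho => //; split => //; rewrite rhoE.
  by rewrite (_ : _ / _ = symbol_im A x y / symbol_re A x y) //; field; rewrite !gt_eqF.
have S1 : S 1.
  apply/SE; exists 0, 0; rewrite expr0n addr0 mulr0 ltr01; split => //.
  by rewrite symbol_root_real ?mulr0 ?subr0 ?expr1n // expr0n mulr0 ltr01.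
have S0 : ~ S 0.
  move=> /SE [x [y [s /esym/eqP]]]; rewrite expf_eq0 => /andP[_].
  rewrite eq_complex /= => /andP[/eqP h _].
  have := mulr_gt0 (symbol_scale_gt0 s) (symbol_re_gt0 A0 A1 s).
  by rewrite h ltxx.
have Spos c : S c%:C -> 0 < c.
  move=> Sc; rewrite ltNge; apply/negP => c0; apply: S0.
  have c1 : 0 < 1 - c by rewrite subr_gt0 (le_lt_trans c0).
  (* The weight t = -c / (1 - c) solves t + (1 - t) c = 0, placing 0 between c and 1. *)
  rewrite (_ : 0 = (- c / (1 - c))%:C * 1 + (1 - - c / (1 - c))%:C * c%:C); last first.
    rewrite mulr1 -rmorphM -rmorphD /= (_ : _ + _ = 0) //; field.
    by rewrite gt_eqF.
  apply: Sconv => //; first by rewrite divr_ge0 ?oppr_ge0 // ltW.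
  by rewrite ler_pdivrMr // mul1r; lra.
have Sre u : S u -> S (complex.Re u)%:C.
  move=> Su; have SuJ : S u^*.
    have [x [y [s uE]]] := (SE u).1 Su.
    apply/SE; exists x, (- y); rewrite sqrrN; split => //.
    by rewrite symbol_rootN -rmorphXn /= uE.
  have := Sconv _ _ 2^-1 _ _ Su SuJ; case: u {Su SuJ} => a b /=.
  rewrite (_ : _ + _ = a%:C); first by apply; lra.
  by apply/eqP; rewrite eq_complex /=; apply/andP; split; apply/eqP; field.
(* Elements of the range near 0 come from points near the boundary circle. *)
pose s := r * (1 - r) / 2.
have s_gt0 : 0 < s by rewrite divr_gt0 // mulr_gt0 // subr_gt0.
have s_half : s <= 2^-1 by rewrite /s; nra.
(* This height makes 1 - |w|^2 equal to s at w = i alpha y0. *)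
pose y0 := Num.sqrt ((1 - s) / A).
have y02 : A * (0 ^+ 2 + y0 ^+ 2) = 1 - s.
  rewrite expr0n add0r sqr_sqrtr; first by field; rewrite gt_eqF.
  by rewrite divr_ge0 ?(ltW A0) // subr_ge0; lra.
have dom0 : A * (0 ^+ 2 + y0 ^+ 2) < 1 by rewrite y02; lra.
have [rho rho0 [rho2 rhoE]] := polar _ _ dom0.
(* Since s^2 = A (1 - r)^2 / 4, rho^2 is (1 - r)^2 times (A / 4) (1 + m) / (s^2 + 4 m). That
   quotient is below 1, as A <= 2 m and m <= 1. *)
have rho_small : rho < 1 - r.
  rewrite -(ltr_pXn2r (n := 2)) ?nnegrE ?subr_ge0 ?ltW // rho2.
  pose m := A * (1 - s).
  have m_ge : A <= 2 * m by rewrite /m; nra.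
  have m_le : m <= 1 by rewrite /m; nra.
  have my : A * y0 ^+ 2 = 1 - s by rewrite -y02 expr0n add0r.
  have d0 : 0 < s ^+ 2 + 4 * m by rewrite addr_gt0 ?exprn_gt0 // mulr_gt0 //; lra.
  have mE : A ^+ 2 * y0 ^+ 2 = m by rewrite /m -my; ring.
  have sE : 1 - A * (0 ^+ 2 + y0 ^+ 2) = s by rewrite y02; ring.
  rewrite symbol_modulus sE -(mulrA 4) mE ?gt_eqF //.
  rewrite mulr0 subr0 expr1n.
  rewrite ltr_pdivrMr // (_ : s ^+ 2 = A * (1 - r) ^+ 2 / 4); last by rewrite /s /A; field.
  have q0 : 0 < (1 - r) ^+ 2 by rewrite exprn_gt0 // subr_gt0.
  rewrite (_ : _ * (1 + m) = (1 - r) ^+ 2 * (A / 4 * (1 + m))); last by field.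
  by rewrite ltr_pM2l // -/A; nra.
pose c := complex.Re (symbol_root A 0 y0 ^+ gamma).
have Sc : S c%:C by apply: Sre; apply/SE; exists 0, y0.
have c0 := Spos _ Sc.
have c_small : c < (1 - r) ^+ gamma.
  rewrite /c rhoE /=; apply: le_lt_trans (_ : rho ^+ gamma < _).
    by rewrite ler_piMr ?exprn_ge0 ?cos_le1 // ltW.
  by rewrite ltrXn2r // ?ltW // -lt0n gamma0.
(* Conjugation settles y < 0. If y = 0, then c = (1 - A x)^gamma with r x < 1, so c >= (1 -
   r)^gamma, against [c_small]. *)
have [x [y [y_gt0 [dom cE]]]] : exists x y, 0 < y /\
    A * (x ^+ 2 + y ^+ 2) < 1 /\ c%:C = symbol_root A x y ^+ gamma.
  have [x [y [dom cE]]] := (SE _).1 Sc.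
  have [y_lt0|y_gt0|y_eq0] := ltgtP y 0.
  - exists x, (- y); rewrite oppr_gt0 sqrrN; do 2?split => //.
    by rewrite symbol_rootN -rmorphXn /= -cE; exact/esym/conjc_real.
  - by exists x, y.
  - exfalso; move: dom cE; rewrite y_eq0 expr0n addr0 => dom.
    rewrite symbol_root_real // -rmorphXn => /complexI cE.
    move: c_small; rewrite cE ltNge => /negP; apply.
    have rx : r * x < 1.
      have : (r * x) ^+ 2 < 1 by rewrite exprMn.
      by rewrite ltNge => /negP h; rewrite ltNge; apply/negP => rx; apply: h; rewrite exprn_ege1.
    rewrite lerXn2r ?nnegrE ?subr_ge0 ?(ltW r1) //; rewrite /A; nra.
have {rho rho0 rho2 rhoE rho_small} [rho rho0 [_ rhoE]] := polar _ _ dom.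
(* gamma * theta is a positive multiple of 2 pi, hence theta > pi / gamma. *)
set theta := atan _ in rhoE.
have theta0 : 0 < theta.
  rewrite -atan0; apply: lt_atan; apply: divr_gt0; first exact: symbol_im_gt0.
  exact: symbol_re_gt0.
have g0 : 0 < gamma%:R :> R by rewrite ltr0n.
have theta_big : pi < gamma%:R * theta.
  move: cE; rewrite rhoE => - [cosE sinE].
  have rg : 0 < rho ^+ gamma by rewrite exprn_gt0.
  (* At angle pi the real part would be negative; at a smaller positive angle the imaginary part
     would be positive. *)
  rewrite ltNge le_eqVlt; apply/negP => /orP[/eqP E|lt].
    by move: cosE c0; rewrite E cospi mulrN1 => ->; rewrite oppr_gt0 ltNge ltW.
  have : 0 < rho ^+ gamma * sin (gamma%:R * theta).
    by rewrite mulr_gt0 // sin_gt0_pi // mulr_gt0.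
  by rewrite -sinE ltxx.
pose phi : R := pi / gamma%:R.
have phi0 : 0 < phi by rewrite divr_gt0 ?pi_gt0.
have phi_theta : phi < theta by rewrite ltr_pdivrMr // mulrC.
have in_itvE t : 0 < t -> t <= theta -> t \in `](- (pi / 2)), (pi / 2)[.
  move=> t0 tt; rewrite in_itv /= (le_lt_trans tt) ?atan_ltpi2 // andbT.
  by rewrite (lt_trans _ t0) // oppr_lt0 divr_gt0 // pi_gt0.
have tan0' : 0 < tan phi.
  have := in_itvE _ phi0 (ltW phi_theta); rewrite in_itv /= => /andP[lo hi].
  by apply: divr_gt0; [apply: sin_gt0_pihalf|apply: cos_gt0_pihalf]; apply/andP.
have tan_lt : tan phi < symbol_im A x y / symbol_re A x y.
  rewrite -[ltRHS]atanK -/theta ltr_tan // in_itvE //; exact: ltW.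
(* At this point the root has argument exactly pi / gamma, so its power is a negative element of S,
   against [Spos]. *)
have [x' [y' [dom' E]]] := symbol_ray_ivt A0 A1 tan0' tan_lt dom.
have [rho' rho'0 [_ rhoE']] := polar _ _ dom'.
have /Spos : S (- rho' ^+ gamma)%:C.
  apply/SE; exists x', y'; split => //.
  rewrite rhoE' E tanK ?in_itvE // ?ltW //.
  rewrite (_ : gamma%:R * phi = pi); last by rewrite /phi; field; rewrite gt_eqF.
  by rewrite cospi sinpi mulr0 mulrN1.
by rewrite oppr_gt0 ltNge exprn_ge0 // ltW.
Qed.

(** * The symbol in the coordinates w = alpha (x + i y), and the conclusion *)

Lemma sqr_norm_scaled (R : realType) (alpha : R[i]) (r x y : R) :
  `|alpha| = r%:C -> `|alpha * (x +i* y)| ^+ 2 = (r ^+ 2 * (x ^+ 2 + y ^+ 2))%:C.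
Proof. by move=> ar; rewrite normrM exprMn ar -add_Re2_Im2 /= rmorphM rmorphXn. Qed.

Lemma disk_scaled (R : realType) (alpha : R[i]) (r x y : R) :
  `|alpha| = r%:C -> r ^+ 2 * (x ^+ 2 + y ^+ 2) < 1 -> disk (alpha * (x +i* y)).
Proof.
move=> ar dom; rewrite /disk /= -(ltr_pXn2r (n := 2)) ?nnegrE // expr1n.
by rewrite (sqr_norm_scaled _ _ ar) ltcR.
Qed.

(** In these coordinates |w|^2 and conj(alpha) w depend on alpha only through its modulus. Clearing
    1 - conj(alpha) w from the Moebius quotient leaves the denominator s - 2 i A y. *)
Lemma berezin_symbol_root (R : realType) (alpha : R[i]) (r x y : R) :
  disk alpha -> `|alpha| = r%:C -> r ^+ 2 * (x ^+ 2 + y ^+ 2) < 1 ->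
  let w := alpha * (x +i* y) in
  (1 - w^* * w) / (1 - w^* * moebius alpha w) = symbol_root (r ^+ 2) x y.
Proof.
move=> da ar dom w.
have aa : alpha * alpha^* = (r ^+ 2)%:C by rewrite -sqr_normc ar rmorphXn.
have ww : w^* * w = (r ^+ 2 * (x ^+ 2 + y ^+ 2))%:C.
  by rewrite mulrC -sqr_normc; exact: sqr_norm_scaled.
have aw : alpha^* * w = (r ^+ 2)%:C * (x +i* y) by rewrite /w mulrA (mulrC _ alpha) aa.
have wa : w^* * alpha = (r ^+ 2)%:C * (x -i* y).
  by rewrite /w rmorphM /= mulrAC (mulrC _ alpha) aa.
have dw : disk w := disk_scaled ar dom.
have az := one_sub_conj_neq0 dw da.
set A := r ^+ 2 in dom aa ww aw wa *.
set s := 1 - A * (x ^+ 2 + y ^+ 2).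
have s0 : 0 < s by rewrite subr_gt0.
have d0 : 0 < s ^+ 2 + 4 * A ^+ 2 * y ^+ 2.
  by rewrite ltr_pwDl ?exprn_gt0 // -mulrA mulr_ge0 ?ler0n // mulr_ge0 ?sqr_ge0.
have den0 : s -i* (2 * A * y) != 0 by rewrite eq_complex /= negb_and gt_eqF.
have -> : 1 - w^* * moebius alpha w = (s -i* (2 * A * y)) / (1 - alpha^* * w).
  rewrite /moebius.
  have -> : 1 - w^* * ((w - alpha) / (1 - alpha^* * w)) =
      (1 - w^* * w - alpha^* * w + w^* * alpha) / (1 - alpha^* * w) by field.
  congr (_ / _); rewrite ww aw wa.
  by apply/eqP; rewrite eq_complex /s /=; apply/andP; split; apply/eqP; ring.
rewrite invfM invrK mulrCA mulrC; apply: (mulIf den0); rewrite mulfVK //.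
rewrite ww aw /symbol_root /symbol_scale /symbol_re /symbol_im -/s.
apply/eqP; rewrite eq_complex /=; apply/andP; split; apply/eqP.
  have -> : 1 - 2 * A * x + A * (x ^+ 2 + y ^+ 2) = 2 * (1 - A * x) - s by rewrite /s; ring.
  rewrite -/s; move: d0; move: (s) => t d0.
  by field; rewrite gt_eqF.
have -> : 1 - 2 * A * x + A * (x ^+ 2 + y ^+ 2) = 2 * (1 - A * x) - s by rewrite /s; ring.
rewrite -/s; move: d0; move: (s) => t d0.
by field; rewrite gt_eqF.
Qed.

(* [Rcomplex R] is C as a vector space over the reals. *)
Theorem theorem3p8 (R : realType) (gamma : nat) (gamma_ge1 : (1 <= gamma)%N)
  (H : rkhs (@kernel_gamma R gamma)) (alpha : R[i]) (alpha_disk : disk alpha) :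
  convex_set (berezin_range (comp_op (H := H) (moebius alpha)) : set (Rcomplex R))
  <-> alpha = 0.
Proof.
split=> [range_convex|alpha0].
  apply/eqP/negPn/negP => alpha0.
  pose r := complex.Re `|alpha|.
  have ar : `|alpha| = r%:C by rewrite /r RRe_real // ger0_real.
  have r0 : 0 < r by rewrite -ltcR -ar normr_gt0.
  have r1 : r < 1 by rewrite -ltcR -ar.
  apply: (@symbol_range_not_convex R r gamma
    (berezin_range (comp_op (H := H) (moebius alpha)))) => // [u|u v t t0 t1 Su Sv].
    split=> [[w dw <-]|[x [y [dom ->]]]].
      have wE : w = alpha * (complex.Re (w / alpha) +i* complex.Im (w / alpha)).
        by case E : (w / alpha) => [a b] /=; rewrite -E mulrC mulfVK.
      have dom : r ^+ 2 * (complex.Re (w / alpha) ^+ 2 + complex.Im (w / alpha) ^+ 2) < 1.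
        by rewrite -ltcR -(sqr_norm_scaled _ _ ar) -wE expr_lt1.
      exists (complex.Re (w / alpha)), (complex.Im (w / alpha)); split => //.
      by rewrite berezin_moebius // {1 2 3 4}wE (berezin_symbol_root alpha_disk ar).
    have dw : disk (alpha * (x +i* y)) := disk_scaled ar dom.
    exists (alpha * (x +i* y)) => //.
    by rewrite berezin_moebius // (berezin_symbol_root alpha_disk ar).
  have := range_convex u v (Itv01 t0 t1); rewrite !inE => /(_ Su Sv).
  suff -> : t%:C * u + (1 - t)%:C * v =
    t *: (u : Rcomplex R) + (1 - t) *: (v : Rcomplex R) by [].
  case: u v {Su Sv} => [a b] [a' b'].
  by apply/eqP; rewrite eq_complex /=; apply/andP; split; apply/eqP; ring.
(* For alpha = 0 the Moebius map is the identity, and the range is a single point. *)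
have symbol1 w : disk w -> berezin_symbol (comp_op (H := H) (moebius alpha)) w = 1.
  move=> dw; rewrite berezin_moebius // alpha0 /moebius subr0 rmorph0 mul0r subr0 divr1.
  by rewrite divff ?expr1n // one_sub_conj_neq0.
have range1 : berezin_range (comp_op (H := H) (moebius alpha)) = [set 1]%classic.
  apply/seteqP; split=> [_ [w dw <-]|_ ->]; first exact: symbol1.
  by exists 0; rewrite ?symbol1 // /disk /= normr0.
rewrite range1 => u v t; rewrite !inE => -> ->.
have : t%:num *: (1 : Rcomplex R) + (1 - t%:num) *: (1 : Rcomplex R) = 1.
  by rewrite -scalerDl addrC subrK scale1r.
exact.
Qed.
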